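(* Let $a>b\ge 1$ be integers, put $a_1=a$, $a_2=b$, and let $a_1,a_2,\dots,a_{k+1},a_{k+2}=0$ be the sequence of integers produced by Euclid's algorithm on $(a,b)$. Let $R_{a,b}^{avg}$ be the average number of recursive calls made by the DEA-R algorithm on inputs $(a,b,c)$, the average being taken over $c\in\{1,\dots,L\}$ with $L=\operatorname{lcm}(a_2,a_3,\dots,a_{k+1})$. Then $$R_{a,b}^{avg}\le \frac{1}{a_2}+\frac{2}{a_3}+\cdots+\frac{k}{a_{k+1}}+(k+1)\left(\frac{a_{k+1}-1}{a_{k+1}}\right).$$
   Context: Euclid's sequence: for integers $a_1>a_2\ge 1$, define $a_{i+2}=a_i \bmod a_{i+1}$ (the remainder of $a_i$ divided by $a_{i+1}$) as long as $a_{i+1}\neq 0$; $k$ is the index such that $a_{k+1}\ne 0$ and $a_{k+2}=0$, so $a_{k+1}=\gcd(a_1,a_2)$. DEA-R algorithm (a recursive algorithm for solving $ax+by=c$ in integers; it returns a value of $y$). It is the recursive function $f(a,b,c)$ defined as follows: 1. If $b=0$, report that there is no solution and stop. 2. Otherwise, if $(c-a) \bmod b=0$, return $(c-a)/b$. 3. Otherwise, return $\bigl(c-f(b,\,a \bmod b,\,c)\cdot a\bigr)/b$. Let $R_{a,b}(c)$ be the total number of calls to $f$, including the initial one, on input $(a,b,c)$. The $i$-th call, if it is reached, has arguments $(a_i,a_{i+1},c)$. Writing $\mathbf{c_i}=\{a_i+Q a_{i+1}: Q\in\mathbb{Z}\}$ for $1\le i\le k$, this means that $R_{a,b}(c)=i$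 if $c\in\mathbf{c_i}$ and $c\notin\mathbf{c_j}$ for all $j<i$, and $R_{a,b}(c)=k+1$ if $c$ lies in none of $\mathbf{c_1},\dots,\mathbf{c_k}$. The average is $R_{a,b}^{avg}=\frac{1}{L}\bigl(1\,n_1+2\,n_2+\cdots+k\,n_k+(k+1)\,n'\bigr)$, where $n_i$ is the number of $c\in\{1,\dots,L\}$ with $c\in\mathbf{c_i}$ and $c\notin \mathbf{c_j}$ for all $j<i$, and $n'$ is the number of $c\in\{1,\dots,L\}$ for which $ax+by=c$ has no integer solution; that is, $R_{a,b}^{avg}=\frac1L\sum_{c=1}^{L}R_{a,b}(c)$. *)

(* Defs.v *)
From HB Require Import structures.
From mathcomp Require Import all_boot all_order all_algebra.

Set Implicit Arguments.
Unset Strict Implicit.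
Unset Printing Implicit Defensive.

Import Order.TTheory GRing.Theory Num.Theory.

Local Open Scope ring_scope.

Definition euclid_step (p : nat * nat) : nat * nat :=
  (p.2, if p.2 == 0%N then 0%N else (p.1 %% p.2)%N).

(* [euclid a b i] is the term a_i of Euclid's sequence, numbered from 1
   (index 0 is unused).  The sequence is continued by zeros once it has reached
   0: since [m %% 0 = m], iterating [modn] alone would come back to the gcd, and
   the index k with a_{k+1} <> 0 and a_{k+2} = 0 would not be unique. *)
Definition euclid (a b i : nat) : nat := (iter i.-1 euclid_step (a, b)).1.

(* The answer ([None] for "no solution") paired with the number of calls
   made, the initial one included.  The recursion is bounded by [fuel];
   [dea_rE] below shows that the bound used in [dea_r] is never reached. *)
Fixpoint dea_r_rec (fuel a b : nat) (c : int) : option int * nat :=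
  if fuel is n.+1 then
    if b == 0%N then (None, 1%N)
    else if ((c - a%:Z) %% b%:Z)%Z == 0 then (Some ((c - a%:Z) %/ b%:Z)%Z, 1%N)
    else let: (r, m) := dea_r_rec n b (a %% b)%N c in
         (omap (fun y => ((c - y * a%:Z) %/ b%:Z)%Z) r, m.+1)
  else (None, 0%N).

Definition dea_r (a b : nat) (c : int) : option int * nat :=
  dea_r_rec b.+1 a b c.

Lemma dea_r_rec_fuel (n a b : nat) (c : int) :
  (b < n)%N -> dea_r_rec n a b c = dea_r a b c.
Proof.
rewrite /dea_r; elim/ltn_ind: b n a => b IHb [//|n] a lt_bn /=.
have [//|b_neq0] := eqVneq b 0%N; case: ifP => // _.
have lt_mb : (a %% b < b)%N by rewrite ltn_mod lt0n.
by rewrite (IHb _ lt_mb n b (leq_trans lt_mb lt_bn)) (IHb _ lt_mb b b lt_mb).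
Qed.

Lemma dea_rE (a b : nat) (c : int) :
  dea_r a b c =
    if b == 0%N then (None, 1%N)
    else if ((c - a%:Z) %% b%:Z)%Z == 0 then (Some ((c - a%:Z) %/ b%:Z)%Z, 1%N)
    else let: (r, m) := dea_r b (a %% b)%N c in
         (omap (fun y => ((c - y * a%:Z) %/ b%:Z)%Z) r, m.+1).
Proof.
rewrite {1}/dea_r /=; have [//|b_neq0] := eqVneq b 0%N.
by rewrite dea_r_rec_fuel // ltn_mod lt0n.
Qed.

Definition dea_r_calls (a b : nat) (c : int) : nat := (dea_r a b c).2.

Definition dea_r_avg (a b L : nat) : rat :=
  (\sum_(1 <= c < L.+1) (dea_r_calls a b c%:Z)%:R) / L%:R.

(* Main.v *)
Require Import Defs.
From HB Require Import structures.
From mathcomp Require Import all_boot all_order all_algebra.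

Import Order.TTheory GRing.Theory Num.Theory.

Local Open Scope ring_scope.

(** The call count at [c] is at most [i] as soon as [c = a_i %[mod a_(i+1)]], and
    it is [k+1] only if no such congruence holds; since [a_(k+1)] divides [a_k],
    the failure of the last one means that [a_(k+1)] does not divide [c].
    Bounding the count by the sum of [i] over all congruences that hold, plus
    [k+1] if [a_(k+1)] does not divide [c], and exchanging sums, it remains to
    note that each modulus divides [L], so that each congruence has exactly
    [L / a_(i+1)] solutions in [{1, ..., L}]. *)

Lemma euclid1 (a b : nat) : euclid a b 1 = a.
Proof. by []. Qed.

Lemma euclid2 (a b : nat) : euclid a b 2 = b.
Proof. by []. Qed.

Lemma euclidSS (a b i : nat) :
  (0 < b)%N -> euclid a b i.+2 = euclid b (a %% b) i.+1.
Proof. by move=> b_gt0; rewrite /euclid -[i.+2.-1]/i.+1 iterSr /euclid_step /= gtn_eqF. Qed.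

(** A zero propagates because each later term is copied from, or reduced modulo, a zero divisor
    slot. Index 1 is excluded: $a_1=0$ would not force $a_2=0$. *)
Lemma euclid_stop (a b i j : nat) :
  (0 < i)%N -> (i <= j)%N -> euclid a b i.+1 = 0%N -> euclid a b j.+1 = 0%N.
Proof.
move=> i_gt0; elim: j => [|j IHj]; first by rewrite leqn0 => /eqP->.
rewrite leq_eqVlt ltnS => /predU1P[-> //|le_ij] /(IHj le_ij).
by case: j le_ij {IHj} => [|j] le_ij; [case: i i_gt0 le_ij | rewrite /euclid /= => ->].
Qed.

Lemma dea_r_callsE (a b c : nat) : (0 < b)%N ->
  dea_r_calls a b c%:Z =
    if (c == a %[mod b])%N then 1%N else (dea_r_calls b (a %% b) c%:Z).+1.
Proof.
move=> b_gt0; rewrite /dea_r_calls dea_rE gtn_eqF //.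
have -> : (((c%:Z - a%:Z) %% b%:Z)%Z == 0) = (c == a %[mod b])%N.
  by rewrite (sameP eqP dvdz_mod0P) -eqz_mod_dvd !modz_nat.
by case: ifP => // _; case: dea_r.
Qed.

(* The offset [m] counts the calls already made, for the induction on [k]. *)
Lemma dea_r_calls_le (k m a b c : nat) : (0 < b)%N ->
  euclid a b k.+1 <> 0%N -> euclid a b k.+2 = 0%N ->
  (m + dea_r_calls a b c%:Z <=
   \sum_(1 <= i < k.+1)
      (m + i) * (c == euclid a b i %[mod euclid a b i.+1])
   + (m + k.+1) * ~~ (euclid a b k.+1 %| c))%N.
Proof.
elim: k m a b => [|k IHk] m a b b_gt0 hk hk0.
  by rewrite euclid2 in hk0; rewrite hk0 in b_gt0.
rewrite dea_r_callsE // big_nat_recl // euclid1 euclid2.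
case: ifP => [_|ncab]; first by rewrite muln1 -addnA leq_addr.
rewrite euclidSS // in hk0; rewrite muln0 add0n addnS -addSn euclidSS // in hk *.
(* The induction hypothesis needs a positive second argument. If $b\mid a$, the next call is the
   last one, and the failed congruence says $b\nmid c$, so the final summand alone pays for both
   calls. *)
case: (posnP (a %% b)) => [ab0|ab_gt0].
  have k0 : k = 0%N.
    by case: k hk {IHk hk0} => // k; rewrite (@euclid_stop _ _ 1).
  rewrite k0 big_geq // euclid1 ab0 /dea_r_calls dea_rE eqxx /=.
  by rewrite /dvdn -[X in ~~ (_ == X)]ab0 ncab muln1 add0n !addnS.
apply: leq_trans (IHk m.+1 _ _ ab_gt0 hk hk0) _.
rewrite -(addSnnS m k.+1) leq_add2r; apply: eq_leq.
by apply: eq_big_nat => i /andP[i_gt0 _]; case: i i_gt0 => // i _;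
  rewrite !euclidSS // addSnnS.
Qed.

(** The range splits into [q] blocks of [d] consecutive integers, each containing exactly one
    solution. *)
Lemma sum_eqmod_nat (d q a : nat) : (0 < d)%N ->
  (\sum_(1 <= c < (q * d).+1) (c == a %[mod d]) = q)%N.
Proof.
move=> d_gt0; have period : (\sum_(0 <= c < q * d) (c == a %[mod d]) = q)%N.
  elim: q => [|q IHq]; first by rewrite big_geq.
  rewrite mulSn (@big_cat_nat _ _ _ d) ?leq_addr //=
    -[X in (_ + \sum_(X <= _ < _) _)%N]add0n big_addn addKn.
  under [X in (_ + X)%N]eq_bigr do rewrite modnDr.
  rewrite IHq big_mkord (bigD1 (Ordinal (ltn_pmod a d_gt0))) //= modn_mod eqxx.
  rewrite big1 // => i /eqP ne_ia; rewrite (modn_small (ltn_ord i)).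
  by case: eqP => // eq_ia; case: ne_ia; apply: val_inj.
(* Passing from $0,\dots,qd-1$ to $1,\dots,qd$ trades the term at 0 for the one at $qd$, which is
   equal modulo [d]. *)
apply: (@addnI (0 == a %[mod d])%N).
rewrite big_add1 -(@big_nat_recl _ 0%N addn _ 0 (fun c => (c == a %[mod d]) : nat)) //.
by rewrite big_nat_recr //= period modnMl mod0n addnC.
Qed.

Theorem mainTheorem2 (a b k : nat)
  (hb : (1 <= b)%N) (hab : (b < a)%N)
  (hk : euclid a b k.+1 <> 0%N) (hk0 : euclid a b k.+2 = 0%N) :
  let L := \big[lcmn/1%N]_(2 <= i < k.+2) euclid a b i in
  dea_r_avg a b L <=
    \sum_(1 <= i < k.+1) (i%:R / (euclid a b i.+1)%:R)
    + k.+1%:R * (((euclid a b k.+1)%:R - 1) / (euclid a b k.+1)%:R).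
Proof.
cbv zeta; set L := (\big[lcmn/1%N]_(_ <= i < _) _).
have e_gt0 i : (0 < i <= k)%N -> (0 < euclid a b i.+1)%N.
  move=> /andP[i_gt0 le_ik]; rewrite lt0n; apply/eqP => ei0; apply: hk.
  exact: euclid_stop i_gt0 le_ik ei0.
have k_gt0 : (0 < k)%N by case: (k) hk0 => //; rewrite euclid2 => b0; rewrite b0 in hb.
have dvdL i : (0 < i <= k)%N -> (euclid a b i.+1 %| L)%N.
  case/andP=> i_gt0 le_ik; rewrite /L (bigD1_seq i.+1) ?iota_uniq ?dvdn_lcml //=.
  by rewrite mem_index_iota !ltnS i_gt0.
have L_gt0 : (0 < L)%N.
  rewrite /L big_nat_cond; apply: (big_ind (leq 1)) => // [x y|[|[|i]]] //.
    by rewrite lcmn_gt0 => -> ->.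
  by rewrite andbT /= ltnS => ?; apply: e_gt0.
have count i x : (0 < i <= k)%N ->
    (\sum_(1 <= c < L.+1) (c == x %[mod euclid a b i.+1]))%N%:R
      = L%:R / (euclid a b i.+1)%:R :> rat.
  move=> hi; have /dvdnP[q ->] := dvdL i hi.
  rewrite sum_eqmod_nat ?e_gt0 // natrM mulfK // pnatr_eq0 -lt0n.
  exact: e_gt0.
have LR : 0 < L%:R :> rat by rewrite ltr0n.
have hkk : (0 < k <= k)%N by rewrite k_gt0 leqnn.
have gR : (euclid a b k.+1)%:R != 0 :> rat by rewrite pnatr_eq0 -lt0n e_gt0.
have ncount : (\sum_(1 <= c < L.+1) ~~ (euclid a b k.+1 %| c))%N%:R
    = L%:R - L%:R / (euclid a b k.+1)%:R :> rat.
  (* Multiples of $a_{k+1}$ are the residue class of 0; with the non-multiples they make up all [L]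
     integers. *)
  rewrite -(count _ 0%N hkk); apply/eqP; rewrite eq_sym subr_eq -natrD -big_split /=.
  rewrite (eq_bigr (fun=> 1%N)) ?sum_nat_const_nat ?subn1 ?muln1 // => c _.
  by rewrite mod0n /dvdn; case: eqP.
rewrite /dea_r_avg ler_pdivrMr // -natr_sum.
apply: le_trans (_ : (\sum_(1 <= c < L.+1) _)%N%:R <= _).
  rewrite ler_nat; apply: leq_sum => c _.
  exact: (@dea_r_calls_le k 0 a b c hb hk hk0).
rewrite big_split /= exchange_big /= natrD natr_sum mulrDl mulr_suml lerD //.
  (* After the pointwise bound nothing more is lost: both parts agree exactly. *)
  rewrite le_eqVlt; apply/orP; left; apply/eqP/eq_big_nat => i hi.
  by rewrite -big_distrr /= natrM count // mulrAC mulrA.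
by rewrite -big_distrr /= natrM ncount -mulrA 2!mulrBl divff // !mul1r [L%:R * _]mulrC.
Qed.
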